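(* Let $P$ be a set of skew-indecomposable (non-empty) permutations and $n\ge0$. Then the staircase encoding $\mathrm{SE}$ is a bijection between $\mathrm{Av}^{(n)}(2314,3124,3142,1\oplus P)$ and $\mathrm{WI}(\mathcal{UDC}(B_n),\mathrm{Av}^{+}(2314,3124,3142,P))$.
   Context: A permutation of size $n$ is a word containing each of $1,\dots,n$ exactly once. $\sigma$ contains $\pi$ if some subsequence of $\sigma$ has the same relative order as $\pi$; otherwise it avoids $\pi$. $\mathrm{Av}(P)$ is the set of permutations avoiding every element of $P$, $\mathrm{Av}^{+}(P)$ its non-empty elements. For $\alpha$ of size $a$, $\beta$ of size $b$: $\alpha\ominus\beta=(\alpha_1+b)\cdots(\alpha_a+b)\beta_1\cdots\beta_b$; a permutation is skew-indecomposable if it is not $\alpha\ominus\beta$ with $\alpha,\beta$ non-empty. $1\oplus\pi=1(\pi_1+1)\cdots(\pi_m+1)$ and $1\oplus P=\{1\oplus\pi:\pi\in P\}$. The empty permutation is not in $P$. A left-to-right minimum of $\sigma$ is an entry $\sigma_i$ with $\sigma_j>\sigma_i$ for all $j<i$; $\mathrm{Av}^{(n)}(Q)$ is the set of permutations in $\mathrm{Av}(Q)$ with exactly $n$ left-to-right minima. $B_n=\{(i,j):1\le i\le j\le n\}$ (row $i$, column $j$, row 1 on top). If $\sigma$ has left-to-right minima at positions $p_1<\dots<p_n$ with values $v_1>\dots>v_n$, each non-minimum entry $\sigma_k$ lies in cell $(i,j)$ where $j$ is the largest index with $p_j<k$ and $i$ the smallest index with $v_i<\sigma_k$. $\mathrm{SE}(\sigma)$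 is the filling of $B_n$ putting in each cell the standardization of the entries of $\sigma$ in that cell (empty permutation if none). $\mathcal{UDC}(B_n)$ is the graph on $B_n$ in which distinct $(i,j),(k,\ell)$ are adjacent iff at least one of: (up) $i>k$ and $j<\ell$ (or symmetrically); (down) $i<k$, $j<\ell$ and $\{i,\dots,k\}\times\{j,\dots,\ell\}\subseteq B_n$ (or symmetrically); (column) $j=\ell$. For a graph $G$ on $B_n$ and a set $S$ of non-empty permutations, $\mathrm{WI}(G,S)$ is the set of fillings of $B_n$ whose non-empty cells form an independent set of $G$ and all contain elements of $S$. ''SE is a bijection between $X$ and $Y$'' means SE restricted to $X$ is injective with image exactly $Y$. *)

(* Defs.v *)
From mathcomp Require Import all_boot.
From mathcomp Require Import boolp classical_sets functions.

Set Implicit Arguments.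
Unset Strict Implicit.
Unset Printing Implicit Defensive.

Local Open Scope nat_scope.

(** Permutations are words over [1, ..., n]; [[::]] is the empty one. *)
Definition is_perm (s : seq nat) : bool := perm_eq s (iota 1 (size s)).

Definition order_iso (s t : seq nat) : Prop :=
  size s = size t /\
  forall i j, i < size s -> j < size s ->
    (nth 0 s i < nth 0 s j) = (nth 0 t i < nth 0 t j).

Definition contains (s p : seq nat) : Prop :=
  exists2 t, subseq t s & order_iso t p.

Definition skew_sum (a b : seq nat) : seq nat :=
  [seq x + size b | x <- a] ++ b.

Definition skew_indecomposable (p : seq nat) : Prop :=
  ~ exists a b, [/\ is_perm a, is_perm b, a != [::], b != [::]
                  & p = skew_sum a b].

Definition one_oplus (p : seq nat) : seq nat := 1 :: [seq x.+1 | x <- p].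

(** Correct for words with distinct letters only. *)
Definition standardize (s : seq nat) : seq nat :=
  [seq (count (fun y => y < x) s).+1 | x <- s].

Definition is_lrmin (s : seq nat) (k : nat) : bool :=
  all (fun l => nth 0 s k < nth 0 s l) (iota 0 k).

(** Positions are counted from 0. *)
Definition lrmin_pos (s : seq nat) : seq nat :=
  [seq k <- iota 0 (size s) | is_lrmin s k].

Definition lrmin_val (s : seq nat) : seq nat :=
  [seq nth 0 s k | k <- lrmin_pos s].

(** Rows and columns are indexed by 0, ..., n-1 instead of 1, ..., n. *)
Definition staircase (n : nat) : {set 'I_n * 'I_n} :=
  [set c : 'I_n * 'I_n | c.1 <= c.2]%SET.

Definition cell (n : nat) : finType := {c : 'I_n * 'I_n | c \in staircase n}.

Definition cell_row n (c : cell n) : 'I_n := (val c).1.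
Definition cell_col n (c : cell n) : 'I_n := (val c).2.

Definition filling (n : nat) : Type := {ffun cell n -> seq nat}.

Definition col_index (s : seq nat) (k j : nat) : bool :=
  let p := lrmin_pos s in
  [&& j < size p, nth 0 p j < k &
      all (fun j' => (nth 0 p j' < k) ==> (j' <= j)) (iota 0 (size p))].

Definition row_index (s : seq nat) (k i : nat) : bool :=
  let v := lrmin_val s in
  [&& i < size v, nth 0 v i < nth 0 s k &
      all (fun i' => (nth 0 v i' < nth 0 s k) ==> (i <= i')) (iota 0 (size v))].

Definition cell_entries (s : seq nat) (i j : nat) : seq nat :=
  [seq nth 0 s k | k <- iota 0 (size s) &
     [&& ~~ is_lrmin s k, row_index s k i & col_index s k j]].

(** Meant for words [s] with exactly [n] left-to-right minima; [n] is a
    separate argument so that all these encodings share one type. *)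
Definition SE (n : nat) (s : seq nat) : filling n :=
  [ffun c : cell n => standardize (cell_entries s (cell_row c) (cell_col c))].

Definition rectangle n (i k j l : 'I_n) : {set 'I_n * 'I_n} :=
  [set c : 'I_n * 'I_n | (i <= c.1 <= k) && (j <= c.2 <= l)]%SET.

Definition up_edge n (c d : cell n) : bool :=
  (cell_row d < cell_row c) && (cell_col c < cell_col d).

Definition down_edge n (c d : cell n) : bool :=
  [&& cell_row c < cell_row d, cell_col c < cell_col d &
      rectangle (cell_row c) (cell_row d) (cell_col c) (cell_col d) \subset staircase n].

Definition UDC (n : nat) : rel (cell n) := fun c d =>
  (c != d) &&
  [|| up_edge c d, up_edge d c, down_edge c d, down_edge d c
    | cell_col c == cell_col d].

Definition independent n (G : rel (cell n)) (A : {set cell n}) : Prop :=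
  forall c d, c \in A -> d \in A -> ~~ G c d.

Definition nonempty_cells n (f : filling n) : {set cell n} :=
  [set c : cell n | f c != [::]]%SET.

Local Open Scope classical_set_scope.

Definition Av (Q : set (seq nat)) : set (seq nat) :=
  [set s | is_perm s /\ forall q, Q q -> ~ contains s q].

Definition Av_plus (Q : set (seq nat)) : set (seq nat) :=
  [set s | Av Q s /\ s <> [::]].

Definition Av_lrmin (n : nat) (Q : set (seq nat)) : set (seq nat) :=
  [set s | Av Q s /\ size (lrmin_pos s) = n].

Definition WI n (G : rel (cell n)) (S : set (seq nat)) : set (filling n) :=
  [set f | independent G (nonempty_cells f) /\
           forall c, c \in nonempty_cells f -> S (f c)].

Definition basis3 : set (seq nat) :=
  [set [:: 2; 3; 1; 4]; [:: 3; 1; 2; 4]; [:: 3; 1; 4; 2]].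

(* Main.v *)
Require Import Defs.
From mathcomp Require Import all_boot.
From mathcomp Require Import boolp classical_sets functions.
From mathcomp Require Import zify.

(** Cut a word into columns, each a left-to-right minimum followed by the
    entries up to the next one.  Avoiding 2314, 3124 and 3142 forces each column
    to lie in one row and every entry of a column to exceed every entry of a
    later column: the non-minima form the skew sum of the cells.  Hence the
    word is determined up to order isomorphism by its cells, which gives
    injectivity.  Conversely, the skew sum of the cells of an independent filling,
    interleaved with the minima, is a word in which the upper part of a copy of
    [1 (+) p], with [p] skew-indecomposable, stays in one cell; the absence of
    down edges is what excludes a copy of 3142 that uses two minima and two cells. *)

Set Implicit Arguments.
Unset Strict Implicit.
Unset Printing Implicit Defensive.

(** * Order isomorphism and standardization *)

Lemma nth_zip_mem (s t : seq nat) i : size s = size t -> i < size s ->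
  (nth 0 s i, nth 0 t i) \in zip s t.
Proof.
move=> est lti; rewrite -(nth_zip 0 0 i est) mem_nth // size_zip est minnn -?est //.
Qed.

(** Comparing pairs of matched letters instead of positions lets order isomorphism pass through
    masks and concatenations. *)
Lemma order_iso_zip (s t : seq nat) :
  order_iso s t <-> size s = size t /\
    {in zip s t &, forall u v, (u.1 < v.1) = (u.2 < v.2)}.
Proof.
split=> -[est H]; split=> //.
  move=> u v /(nthP (0, 0)) [i + <-] /(nthP (0, 0)) [j + <-].
  rewrite !size_zip -est minnn => lti ltj.
  by rewrite !nth_zip //=; apply: H.
by move=> i j lti ltj; apply: (H _ _ (nth_zip_mem est lti) (nth_zip_mem est ltj)).
Qed.

Lemma order_iso_sym s t : order_iso s t -> order_iso t s.
Proof. by case=> est H; split=> // i j; rewrite -est => ? ?; rewrite H. Qed.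

Lemma order_iso_trans t s u : order_iso s t -> order_iso t u -> order_iso s u.
Proof.
case=> est H [etu H']; split=> [|i j lti ltj]; first by rewrite est.
by rewrite H // H' -?est.
Qed.

Lemma order_iso_map (f : nat -> nat) s :
  {in s &, forall x y, (x < y) = (f x < f y)} -> order_iso s (map f s).
Proof.
move=> H; split=> [|i j lti ltj]; first by rewrite size_map.
by rewrite !(nth_map 0) // H ?mem_nth.
Qed.

Lemma order_iso_standardize s : order_iso s (standardize s).
Proof.
apply: order_iso_map => x y xs ys; rewrite ltnS.
case: ltnP => [xy | yx]; last first.
  by apply/esym/negbTE; rewrite -leqNgt; apply: sub_count => z /= /leq_trans; apply.
(* The letters below [x] and the copies of [x] are disjoint and all lie below [y]; since [x] occurs,
   the rank increases strictly. *)
apply/esym/(@leq_trans (count (fun z => z < x) s + count_mem x s)).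
  by rewrite -addn1 leq_add2l -has_count; apply/hasP; exists x => /=.
rewrite -count_predUI [X in _ + X](_ : _ = 0) ?addn0.
  by apply: sub_count => z /= /orP [/ltn_trans|/eqP ->]; first apply.
apply/eqP; rewrite -leqn0 leqNgt -has_count; apply/hasPn => z _ /=.
by rewrite negb_and -leqNgt; case: eqP => [->|]; rewrite ?leqnn ?orbT.
Qed.

Lemma order_iso_count s t i : order_iso s t -> i < size s ->
  count (fun y => y < nth 0 s i) s = count (fun y => y < nth 0 t i) t.
Proof.
move=> [est H] lti; rewrite -{2}[s](mkseq_nth 0) -{2}[t](mkseq_nth 0) !count_map -est.
by apply: eq_in_count => j; rewrite mem_iota /= => ltj; rewrite H.
Qed.

(** Ranks depend only on comparisons between letters. With the converse below, standardization is a
    complete invariant of order isomorphism. *)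
Lemma standardize_order_iso s t : order_iso s t -> standardize s = standardize t.
Proof.
move=> ist; have [est _] := ist.
apply: (@eq_from_nth _ 0); rewrite !size_map // => i lti.
by rewrite !(nth_map 0) -?est // (order_iso_count ist lti).
Qed.

Lemma standardize_eq_order_iso s t :
  standardize s = standardize t -> order_iso s t.
Proof.
move=> e; apply: (order_iso_trans (order_iso_standardize s)).
by rewrite e; apply/order_iso_sym/order_iso_standardize.
Qed.

Lemma standardize_nil s : (standardize s == [::]) = (s == [::]).
Proof. by case: s. Qed.

Lemma is_perm_uniq s : is_perm s -> uniq s.
Proof. by move/perm_uniq ->; apply: iota_uniq. Qed.

Lemma is_perm_mem s x : is_perm s -> (x \in s) = (0 < x <= size s).
Proof. by move/perm_mem ->; rewrite mem_iota add1n ltnS. Qed.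

Lemma count_ltn_iota1 n x : 0 < x -> x <= n ->
  count (fun y => y < x) (iota 1 n) = x.-1.
Proof.
move=> x0 xn; rewrite -(subnKC (leq_trans (leq_pred x) xn)) iotaD count_cat.
rewrite (eq_in_count (a2 := predT)) => [|y]; last first.
  by rewrite mem_iota => /andP [_ h] /=; lia.
rewrite count_predT size_iota [X in _ + X](_ : _ = 0) ?addn0 //.
apply/eqP; rewrite -leqn0 leqNgt -has_count; apply/hasPn => y.
by rewrite mem_iota => h /=; lia.
Qed.

Lemma standardize_perm s : is_perm s -> standardize s = s.
Proof.
move=> ps; rewrite -[RHS]map_id; apply/eq_in_map => x xs.
move: (xs); rewrite (is_perm_mem x ps) => /andP [x0 xs1].
by rewrite (seq.permP ps) count_ltn_iota1 // prednK.
Qed.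

Lemma order_iso_perm_eq s t : is_perm s -> is_perm t -> order_iso s t -> s = t.
Proof.
by move=> /standardize_perm {2}<- /standardize_perm {2}<- /standardize_order_iso.
Qed.

Lemma order_iso_uniq s t : order_iso s t -> uniq s -> uniq t.
Proof.
move=> [est H] us; apply/(uniqP 0) => i j; rewrite !inE -est => lti ltj e.
apply/eqP; rewrite -(nth_uniq 0 lti ltj us).
by case: ltngtP; rewrite // H // e ltnn.
Qed.

(** The ranks are distinct and lie in an interval with as many elements as there are letters, so
    they exhaust it. *)
Lemma is_perm_standardize s : uniq s -> is_perm (standardize s).
Proof.
move=> us; have uS := order_iso_uniq (order_iso_standardize s) us.
apply: uniq_perm => //; first exact: iota_uniq.
apply: (uniq_min_size uS _ _).2; last by rewrite size_iota.
move=> _ /mapP [x xs ->]; rewrite mem_iota size_map add1n /= !ltnS.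
rewrite -(count_predC (fun y => y < x) s) -[X in X < _]addn0 ltn_add2l.
by rewrite -has_count; apply/hasP; exists x; rewrite //= ltnn.
Qed.

(** * Pattern containment and subsequences of words with distinct letters *)

Lemma mask_zip (b : bitseq) (s t : seq nat) : size s = size t ->
  zip (mask b s) (mask b t) = mask b (zip s t).
Proof.
elim: b s t => [|[] b IH] [|x s] [|y t] //= [e]; rewrite ?IH //.
Qed.

(** The mask that selects an occurrence in one word selects one at the same positions of the
    other. *)
Lemma order_iso_contains s t q : order_iso s t -> contains s q -> contains t q.
Proof.
move=> /order_iso_zip [est H] [u /subseqP [b sb ->] isq].
exists (mask b t); first by apply/subseqP; exists b; rewrite -?est.
apply: order_iso_trans isq; apply/order_iso_sym/order_iso_zip; split.
  by rewrite !size_mask -?est.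
by move=> v w; rewrite mask_zip // => /mem_mask hv /mem_mask hw; apply: H.
Qed.

Lemma contains_standardize s q : contains (standardize s) q <-> contains s q.
Proof.
by split; apply: order_iso_contains; first apply: order_iso_sym;
  apply: order_iso_standardize.
Qed.

Lemma subseq_contains s t q : subseq s t -> contains s q -> contains t q.
Proof. by move=> st [u us]; exists u => //; apply: subseq_trans st. Qed.

Lemma pairwise_index (s : seq nat) :
  uniq s -> pairwise (fun x y => index x s < index y s) s.
Proof.
by move=> us; apply/(pairwiseP 0) => i j; rewrite !inE => ? ? ?; rewrite !index_uniq.
Qed.

Lemma subseq_pairwise_index (s t : seq nat) : uniq s -> subseq t s ->
  pairwise (fun x y => index x s < index y s) t.
Proof. by move=> us ts; apply: subseq_pairwise ts _; apply: pairwise_index. Qed.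

(** Both [t] and the part of [s] with letters in [t] are strictly sorted by position and have the
    same letters, hence coincide. Exhibiting an occurrence thus reduces to comparing indices. *)
Lemma sorted_index_subseq (s t : seq nat) : uniq s -> {subset t <= s} ->
  sorted (fun x y => index x s < index y s) t -> subseq t s.
Proof.
move=> us ts st; have tr : transitive (fun x y => index x s < index y s).
  by move=> y x z; apply: ltn_trans.
apply/(subseq_uniqP us); apply: (irr_sorted_eq tr) => [x|//||x].
- exact: ltnn.
- apply: (sorted_filter tr); apply: pairwise_sorted; exact: pairwise_index.
- by rewrite mem_filter; case: (boolP (x \in t)) => // /ts ->.
Qed.

(** * The forbidden patterns and skew sums *)

Lemma order_iso_2314 a b c d :
  order_iso [:: a; b; c; d] [:: 2; 3; 1; 4] <-> [/\ c < a, a < b & b < d].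
Proof.
split=> [[_ H]|[ca ab bd]].
  by split; [apply: (etrans (H 2 0 _ _))|apply: (etrans (H 0 1 _ _))|
             apply: (etrans (H 1 3 _ _))].
by split=> // -[|[|[|[|?]]]] [|[|[|[|?]]]] //= _ _; lia.
Qed.

Lemma order_iso_3124 a b c d :
  order_iso [:: a; b; c; d] [:: 3; 1; 2; 4] <-> [/\ b < c, c < a & a < d].
Proof.
split=> [[_ H]|[? ? ?]].
  by split; [apply: (etrans (H 1 2 _ _))|apply: (etrans (H 2 0 _ _))|
             apply: (etrans (H 0 3 _ _))].
by split=> // -[|[|[|[|?]]]] [|[|[|[|?]]]] //= _ _; lia.
Qed.

Lemma order_iso_3142 a b c d :
  order_iso [:: a; b; c; d] [:: 3; 1; 4; 2] <-> [/\ b < d, d < a & a < c].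
Proof.
split=> [[_ H]|[? ? ?]].
  by split; [apply: (etrans (H 1 3 _ _))|apply: (etrans (H 3 0 _ _))|
             apply: (etrans (H 0 2 _ _))].
by split=> // -[|[|[|[|?]]]] [|[|[|[|?]]]] //= _ _; lia.
Qed.

Lemma order_iso_one_oplus a u p : is_perm p ->
  order_iso (a :: u) (one_oplus p) <-> order_iso u p /\ all (fun x => a < x) u.
Proof.
move=> pp; have p_gt0 i : i < size p -> 0 < nth 0 p i.
  by move=> lti; have := mem_nth 0 lti; rewrite is_perm_mem // => /andP [].
split=> [[[sz] H]|[[sz H] /allP au]].
  rewrite size_map in sz; split; last first.
    apply/(all_nthP 0) => i lti; rewrite (H 0 i.+1) //= (nth_map 0) -?sz //.
    by rewrite ltnS p_gt0 // -sz.
  split=> // i j lti ltj; have := H i.+1 j.+1 lti ltj.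
  by rewrite /= !(nth_map 0) -?sz // ltnS.
split=> [|[|i] [|j]] /=; rewrite ?size_map ?sz ?ltnn // ?ltnS => lti ltj.
- by rewrite (nth_map 0) // ltnS p_gt0 // au // mem_nth // sz.
- by rewrite (nth_map 0) // ltnNge ltnW // au // mem_nth // sz.
- by rewrite !(nth_map 0) // ltnS H // sz.
Qed.

Lemma standardize_skew_cat s t :
  {in s & t, forall x y, y < x} ->
  standardize (s ++ t) = skew_sum (standardize s) (standardize t).
Proof.
move=> H; rewrite /skew_sum /standardize map_cat size_map -map_comp.
congr (_ ++ _); apply/eq_in_map => x xs /=; rewrite count_cat.
  rewrite addSn (eq_in_count (s := t) (a2 := predT)) ?count_predT //.
  by move=> y yt /=; rewrite H.
rewrite (eq_in_count (s := s) (a2 := pred0)) ?count_pred0 //.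
by move=> y ys /=; apply/negbTE; rewrite -leqNgt ltnW // H.
Qed.

(** If both pieces were non-empty, their standardizations would write [p] as a skew sum. *)
Lemma skew_indecomposable_split p u v :
  is_perm p -> skew_indecomposable p -> order_iso (u ++ v) p ->
  {in u & v, forall x y, y < x} -> u = [::] \/ v = [::].
Proof.
move=> pp sp iso H; case: (eqVneq u [::]) => [|u0]; first by left.
case: (eqVneq v [::]) => [|v0]; [by right | case: sp].
have := order_iso_uniq (order_iso_sym iso) (is_perm_uniq pp).
rewrite cat_uniq => /and3P [uu _ uv].
exists (standardize u), (standardize v).
split; rewrite ?is_perm_standardize ?standardize_nil //.
by rewrite -standardize_skew_cat // (standardize_order_iso iso) standardize_perm.
Qed.

(** By the hypothesis the letters satisfying [Q] form a prefix. This serves to split an occurrence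
    into its letters in one column and the later ones. *)
Lemma filter_cat_predC (Q : pred nat) u :
  pairwise (fun x y => Q y ==> Q x) u ->
  u = filter Q u ++ filter (predC Q) u.
Proof.
elim: u => //= x u IH /andP [/allP xu /IH {1}->]; case: ifP => Qx //=.
rewrite (eq_in_filter (a2 := pred0)) ?filter_pred0 //=.
by move=> y /xu; rewrite Qx implybF => /negbTE ->.
Qed.

(** * Words cut into columns *)

Fixpoint word (m : nat -> nat) (c : nat -> seq nat) (n : nat) : seq nat :=
  if n is n'.+1 then word m c n' ++ m n' :: c n' else [::].

(** These conditions make the [m j] exactly the left-to-right minima of the word, each heading its
    column. *)
Definition wf_columns (m : nat -> nat) (c : nat -> seq nat) (n : nat) : Prop :=
  (forall i j, i < j -> j < n -> m j < m i) /\
  (forall j x, j < n -> x \in c j -> m j < x).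

(** Equal to [n] when no minimum is below [x]. *)
Definition row_of (m : nat -> nat) (n x : nat) : nat :=
  find (fun v => v < x) (mkseq m n).

Lemma wf_columnsS m c n : wf_columns m c n.+1 -> wf_columns m c n.
Proof.
by move=> [H1 H2]; split=> [i j ij jn|j x jn]; [apply: H1|apply: H2]; rewrite // ltnW.
Qed.

Lemma eq_word m c m' c' n : (forall j, j < n -> m j = m' j) ->
  (forall j, j < n -> c j = c' j) -> word m c n = word m' c' n.
Proof.
elim: n => //= n IH Hm Hc.
rewrite (Hm n) ?(Hc n) ?IH // => j jn; [apply: Hm|apply: Hc]; exact: ltnW.
Qed.

Lemma mem_word m c n x :
  reflect (exists2 j, j < n & x \in m j :: c j) (x \in word m c n).
Proof.
apply: (iffP idP).
  elim: n => //= n IH; rewrite mem_cat => /orP [/IH [j jn jx]|xn].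
    by exists j; first exact: ltnW.
  by exists n.
case=> j; elim: n => //= n IH; rewrite ltnS leq_eqVlt mem_cat.
by case/predU1P=> [-> ->|jn /(IH jn) ->]; rewrite ?orbT.
Qed.

Lemma wf_word_gt m c n x : wf_columns m c n.+1 -> x \in word m c n -> m n < x.
Proof.
move=> [Hm Hc] /mem_word [j jn]; rewrite inE => /predU1P [->|xj].
  exact: Hm.
by apply: ltn_trans (Hm j n _ _) (Hc j x _ xj); rewrite // ltnW.
Qed.

Lemma word_index_lt m c n i j x y : uniq (word m c n) -> i < j -> j < n ->
  x \in m i :: c i -> y \in m j :: c j ->
  index x (word m c n) < index y (word m c n).
Proof.
elim: n => //= n IH; rewrite cat_uniq => /and3P [uw /hasPn dis _] ij jn xi yj.
have xw : x \in word m c n.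
  by apply/mem_word; exists i => //; rewrite (leq_trans ij).
rewrite !index_cat xw; move: jn; rewrite ltnS leq_eqVlt => /predU1P [ejn|jn].
  rewrite ejn in yj; rewrite (negbTE (dis _ yj)).
  by rewrite (leq_trans _ (leq_addr _ _)) // index_mem.
have -> : y \in word m c n by apply/mem_word; exists j.
exact: IH.
Qed.

Lemma word_index_min m c n j x : uniq (word m c n) -> j < n -> x \in c j ->
  index (m j) (word m c n) < index x (word m c n).
Proof.
elim: n => //= n IH; rewrite cat_uniq => /and3P [uw /hasPn dis unc].
rewrite ltnS leq_eqVlt => /predU1P [-> xn|jn xj].
  rewrite !index_cat !(negbTE (dis _ _)) ?inE ?eqxx ?xn ?orbT //= eqxx ltn_add2l.
  by case: eqP => // e; move: unc; rewrite /= e xn.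
rewrite !index_cat; have -> : m j \in word m c n.
  by apply/mem_word; exists j; rewrite ?mem_head.
have -> : x \in word m c n by apply/mem_word; exists j; rewrite // inE xj orbT.
exact: IH.
Qed.

Lemma word_index_le m c n i j x y : uniq (word m c n) -> i < n ->
  x \in m i :: c i -> y \in m j :: c j ->
  index x (word m c n) <= index y (word m c n) -> i <= j.
Proof.
move=> uw lt_in xi yj; rewrite leqNgt [i <= j]leqNgt; apply: contra => ij.
exact: word_index_lt yj xi.
Qed.

Lemma uniq_word m c n : wf_columns m c n ->
  (forall i j x, i < n -> j < n -> x \in c j -> x != m i) ->
  (forall i j x, i < j -> j < n -> x \in c i -> x \notin c j) ->
  (forall j, j < n -> uniq (c j)) -> uniq (word m c n).
Proof.
elim: n => //= n IH wf Hm Hd Hu; rewrite cat_uniq /= Hu // IH ?andbT /=.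
- apply/andP; split; last by apply/negP => /(Hm n n _ (ltnSn n) (ltnSn n)); rewrite eqxx.
  apply/norP; split; first by apply/negP => /(wf_word_gt wf); rewrite ltnn.
  apply/hasPn => x xn; apply/mem_word => -[j jn]; rewrite inE => /predU1P [e|xj].
    by move: (Hm j n x (ltnW jn) (ltnSn n) xn); rewrite e eqxx.
  by move: (Hd _ _ _ jn (ltnSn n) xj); rewrite xn.
- exact: wf_columnsS wf.
- by move=> i j x lt_in jn; apply: Hm; exact: ltnW.
- by move=> i j x ij jn; apply: Hd; rewrite // ltnW.
- by move=> j jn; apply/Hu/ltnW.
Qed.

Lemma filter_mem_column m c n j : uniq (word m c n) -> j < n ->
  [seq x <- word m c n | x \in c j] = c j.
Proof.
move=> uw jn; apply/esym; apply/(subseq_uniqP uw).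
elim: n jn {uw} => //= n IH; rewrite ltnS leq_eqVlt => /predU1P [->|/IH sj].
  by apply: subseq_trans (suffix_subseq _ _); apply: subseq_cons.
by apply: subseq_trans (prefix_subseq _ _).
Qed.

Lemma column_subseq m c n j t : uniq (word m c n) -> j < n ->
  subseq t (word m c n) -> {subset t <= c j} -> subseq t (c j).
Proof.
move=> uw jn tw tc; rewrite -(filter_mem_column uw jn) subseq_filter tw andbT.
exact/allP.
Qed.

Lemma column_cons_subseq m c n j : j < n -> subseq (m j :: c j) (word m c n).
Proof.
elim: n => //= n IH; rewrite ltnS leq_eqVlt => /predU1P [->|/IH sj].
  exact: suffix_subseq.
by apply: subseq_trans (prefix_subseq _ _).
Qed.

(** The minima decrease, so those below [x] form a final segment, which starts at its row.
    Comparisons with minima thereby become comparisons of rows. *)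
Lemma min_lt_row_of m c n x i : wf_columns m c n -> i < n ->
  (m i < x) = (row_of m n x <= i).
Proof.
move=> [Hm _] lt_in; apply/idP/idP => [mx|ri].
  rewrite leqNgt; apply/negP => /(before_find 0).
  by rewrite nth_mkseq // mx.
have hasx : has (fun v => v < x) (mkseq m n).
  by rewrite has_find size_mkseq (leq_ltn_trans ri).
have := nth_find 0 hasx; rewrite -/(row_of m n x) nth_mkseq; last exact: leq_ltn_trans ri _.
apply: leq_ltn_trans; move: ri; rewrite leq_eqVlt => /predU1P [->//|ri].
by rewrite ltnW // Hm.
Qed.

(** The minimum heading its column is below [x]; hence only cells of the staircase are occupied. *)
Lemma row_of_le m c n j x : wf_columns m c n -> j < n -> x \in c j ->
  row_of m n x <= j.
Proof. by move=> wf jn xj; rewrite -(min_lt_row_of x wf jn); case: wf => _; apply. Qed.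

Lemma row_of_unique m c n i x : wf_columns m c n -> i < n ->
  (forall i', i' < n -> (m i' < x) = (i <= i')) -> row_of m n x = i.
Proof.
move=> wf lt_in H; have le_ri : row_of m n x <= i by rewrite -(min_lt_row_of x wf) // H.
have rn := leq_ltn_trans le_ri lt_in.
by apply/eqP; rewrite eqn_leq le_ri -H // (min_lt_row_of x wf rn) leqnn.
Qed.

(** Reading from left to right, a letter below the latest minimum opens a new column and any other
    letter joins the last one. *)
Lemma word_exists s : uniq s ->
  exists n m c, s = word m c n /\ wf_columns m c n.
Proof.
elim/last_ind: s => [_|s x IH].
  by exists 0, id, (fun=> [::]); split=> //; split.
rewrite rcons_uniq => /andP [xs /IH [n [m [c [es wf]]]]].
case: n => [|n] in es wf.
  exists 1, (fun=> x), (fun=> [::]); rewrite es; split=> //; split=> //.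
  by case=> [|i] [].
case: (ltnP x (m n)) => [lt_xm|le_mx].
  exists n.+2, (fun j => if j == n.+1 then x else m j),
    (fun j => if j == n.+1 then [::] else c j); split.
    rewrite -cats1 es [in RHS]/= eqxx; congr (_ ++ _).
    by apply: (@eq_word _ _ _ _ n.+1) => j jn; rewrite ltn_eqF.
  case: wf => Hm Hc; split=> [i j ij|j y].
    rewrite ltnS leq_eqVlt; case: eqP ij => [-> ij _|/eqP nj ij /= jn]; last first.
      by rewrite ltn_eqF ?Hm // (ltn_trans ij).
    rewrite ltn_eqF //; apply: leq_trans lt_xm _.
    by move: ij; rewrite ltnS leq_eqVlt => /predU1P [->//|/Hm/(_ (ltnSn n))/ltnW].
  by rewrite ltnS leq_eqVlt; case: eqP => // nj /= jn; apply: Hc.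
exists n.+1, m, (fun j => if j == n then rcons (c n) x else c j); split.
  rewrite -cats1 es /= eqxx -cats1 -catA; congr (_ ++ _).
  by apply: eq_word => j jn //; rewrite ltn_eqF.
case: wf => Hm Hc; split=> // j y jn; case: eqP => [->|_]; last exact: Hc.
rewrite mem_rcons inE => /predU1P [->|/Hc]; last exact.
rewrite ltn_neqAle le_mx andbT; apply: contraNneq xs => <-.
by rewrite es /= mem_cat mem_head orbT.
Qed.

(** * Left-to-right minima and cells of a word cut into columns *)

Lemma is_lrmin_catl s t k : k < size s -> is_lrmin (s ++ t) k = is_lrmin s k.
Proof.
move=> ks; apply: eq_in_all => l; rewrite mem_iota /= => lk.
by rewrite !nth_cat ks (ltn_trans lk ks).
Qed.

Lemma is_lrmin_cat_eq s t x : {in s, forall y, x < y} ->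
  is_lrmin (s ++ x :: t) (size s).
Proof.
move=> H; apply/allP => l; rewrite mem_iota /= => ls.
by rewrite !nth_cat ltnn subnn /= ls H // mem_nth.
Qed.

Lemma is_lrmin_cat_gt (s t : seq nat) x k : {in t, forall y, x < y} ->
  size s < k -> k < size (s ++ x :: t) -> is_lrmin (s ++ x :: t) k = false.
Proof.
move=> H sk; rewrite size_cat /= => ks; apply/negP => /allP/(_ (size s)).
rewrite mem_iota /= sk => /(_ isT); rewrite !nth_cat ltnn subnn /=
  [k < size s]ltnNge (ltnW sk) /=.
have -> : k - size s = (k - size s).-1.+1 by lia.
have lt_t : (k - size s).-1 < size t by lia.
by rewrite /= ltnNge ltnW // H // mem_nth.
Qed.

Lemma lrmin_pos_cat (s t : seq nat) x :
  {in s, forall y, x < y} -> {in t, forall y, x < y} ->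
  lrmin_pos (s ++ x :: t) = rcons (lrmin_pos s) (size s).
Proof.
move=> Hs Ht; rewrite /lrmin_pos {1}size_cat iotaD filter_cat /= is_lrmin_cat_eq //.
rewrite -cats1; congr (_ ++ _ :: _).
  by apply: eq_in_filter => k; rewrite mem_iota => /= ks; rewrite is_lrmin_catl.
rewrite (eq_in_filter (a2 := pred0)) ?filter_pred0 // => k.
rewrite mem_iota => /andP [sk ks]; rewrite is_lrmin_cat_gt //.
by rewrite size_cat /=; lia.
Qed.

Lemma lrmin_pos_wordS m c n : wf_columns m c n.+1 ->
  lrmin_pos (word m c n.+1) = rcons (lrmin_pos (word m c n)) (size (word m c n)).
Proof.
move=> wf; apply: lrmin_pos_cat => x; first exact: wf_word_gt.
by case: wf => _; apply.
Qed.

Lemma size_lrmin_pos_word m c n : wf_columns m c n ->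
  size (lrmin_pos (word m c n)) = n.
Proof.
elim: n => // n IH wf; rewrite lrmin_pos_wordS // size_rcons IH //.
exact: wf_columnsS wf.
Qed.

Lemma lrmin_pos_lt s k : k \in lrmin_pos s -> k < size s.
Proof. by rewrite mem_filter mem_iota => /andP []. Qed.

Lemma lrmin_val_word m c n : wf_columns m c n -> lrmin_val (word m c n) = mkseq m n.
Proof.
elim: n => // n IH wf; rewrite /lrmin_val lrmin_pos_wordS // map_rcons mkseqS.
rewrite -IH; last exact: wf_columnsS wf.
congr rcons; last by rewrite /= nth_cat ltnn subnn.
by apply/eq_in_map => k /lrmin_pos_lt ks; rewrite /= nth_cat ks.
Qed.

Lemma row_index_word m c n k i : wf_columns m c n -> i < n ->
  row_index (word m c n) k i = (row_of m n (nth 0 (word m c n) k) == i).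
Proof.
move=> wf lt_in; rewrite /row_index lrmin_val_word // size_mkseq lt_in /=.
rewrite nth_mkseq // (min_lt_row_of _ wf) //; set r := row_of _ _ _.
apply/andP/eqP => [[ri /allP H]|e].
  have rn := leq_ltn_trans ri lt_in.
  apply/eqP; rewrite eqn_leq ri; have := H r; rewrite mem_iota /= nth_mkseq //.
  by rewrite (min_lt_row_of _ wf) // leqnn; apply.
rewrite e leqnn; split=> //; apply/allP => i'; rewrite mem_iota /= => i'n.
by rewrite nth_mkseq // (min_lt_row_of _ wf) // -/r e implybb.
Qed.

Lemma map_filter_iota (s : seq nat) (Q : pred nat) i j : i + j <= size s ->
  [seq nth 0 s k | k <- iota i j & Q (nth 0 s k)] =
  [seq x <- take j (drop i s) | Q x].
Proof. by move=> ij; rewrite -(map_nth_iota 0 _) ?filter_map //; lia. Qed.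

(** The arbitrary [Q] stands for the row condition: rows refer to all [n] minima, so fixing that
    condition would break the induction on the number of columns. *)
Lemma filter_column_word m c n j (Q : pred nat) : wf_columns m c n -> j < n ->
  let w := word m c n in
  [seq nth 0 w k | k <- iota 0 (size w) &
     [&& ~~ is_lrmin w k, Q (nth 0 w k) & col_index w k j]] =
  [seq x <- c j | Q x].
Proof.
elim: n => // n IH wf jn w; have wf' := wf_columnsS wf.
set s := word m c n in IH; have ew : w = s ++ m n :: c n by [].
have Hs : {in s, forall y, m n < y} by move=> y; apply: wf_word_gt.
have Hc : {in c n, forall y, m n < y} by case: wf => _ Hc y; apply: Hc.
have ep : lrmin_pos w = rcons (lrmin_pos s) (size s) by apply: lrmin_pos_cat.
have sp : size (lrmin_pos s) = n by apply: size_lrmin_pos_word.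
have pn : nth 0 (lrmin_pos w) n = size s by rewrite ep nth_rcons sp ltnn eqxx.
have pl l : l < n -> nth 0 (lrmin_pos w) l = nth 0 (lrmin_pos s) l.
  by move=> ln; rewrite ep nth_rcons sp ln.
have spw : size (lrmin_pos w) = n.+1 by rewrite ep size_rcons sp.
(* Letters before the last minimum keep the column they had in the shorter word; those after it lie
   in column [n]. *)
have colL k : k < size s -> col_index w k j = (j < n) && col_index s k j.
  move=> ks; rewrite /col_index spw sp jn -(addn1 n) iotaD all_cat /= add0n pn.
  rewrite [size s < k]ltnNge (ltnW ks) /= andbT.
  move: jn; rewrite ltnS leq_eqVlt => /predU1P [->|jn].
    by rewrite ltnn pn ltnNge (ltnW ks).
  rewrite jn pl //=; congr andb; apply: eq_in_all => l.
  by rewrite mem_iota /= => ln; rewrite pl.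
have colR k : size s < k -> col_index w k j = (j == n).
  move=> sk; rewrite /col_index spw jn andTb.
  apply/andP/eqP => [[_ /allP/(_ n)]|->].
    rewrite mem_iota pn sk /= => /(_ (ltnSn n)) nj.
    by apply/eqP; rewrite eqn_leq nj -ltnS jn.
  rewrite pn sk; split=> //; apply/allP => l.
  by rewrite mem_iota /= ltnS => ->; rewrite implybT.
have -> : size w = size s + (size (c n)).+1 by rewrite ew size_cat.
rewrite iotaD filter_cat map_cat /= add0n.
have -> : is_lrmin w (size s) by apply: is_lrmin_cat_eq.
rewrite /= [in X in _ ++ X](eq_in_filter
  (a2 := fun k => (j == n) && Q (nth 0 w k))); last first.
  move=> k; rewrite mem_iota => /andP [sk ks]; rewrite colR //.
  rewrite is_lrmin_cat_gt //=; first exact: andbC.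
  by rewrite size_cat /= addnS -addSn.
rewrite [in X in X ++ _](eq_in_filter (a2 := fun k => (j < n) &&
  [&& ~~ is_lrmin s k, Q (nth 0 s k) & col_index s k j])); last first.
  move=> k; rewrite mem_iota /= => ks; rewrite colL // ew is_lrmin_catl // nth_cat ks.
  by case: (j < n); rewrite ?andbF.
move: jn; rewrite ltnS leq_eqVlt => /predU1P [->|jn].
  rewrite ltnn eqxx /= filter_pred0 /= map_filter_iota ew; last by rewrite size_cat /=; lia.
  by rewrite drop_cat ltnNge leqnSn /= subSnn /= drop0 take_size.
rewrite jn ltn_eqF //= filter_pred0 cats0 -(IH wf' jn).
apply/eq_in_map => k; rewrite mem_filter mem_iota => /and3P [_ _ ks].
by rewrite ew nth_cat ks.
Qed.

Lemma cell_entries_word m c n i j : wf_columns m c n -> i < n -> j < n ->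
  cell_entries (word m c n) i j = [seq x <- c j | row_of m n x == i].
Proof.
move=> wf lt_in jn; rewrite -(filter_column_word (fun x => row_of m n x == i) wf jn).
rewrite /cell_entries; congr map; apply: eq_filter => k.
by rewrite row_index_word.
Qed.

Lemma SE_word m c n (d : cell n) : wf_columns m c n ->
  SE n (word m c n) d =
  standardize [seq x <- c (cell_col d) | row_of m n x == cell_row d].
Proof. by move=> wf; rewrite ffunE cell_entries_word. Qed.

(** * Pattern avoidance and columns *)

(** The third clause says that no two non-empty cells form a down edge: for
    [row x < row y], the rectangle they span fits iff [row y <= i]. *)
Definition skew_columns (m : nat -> nat) (c : nat -> seq nat) (n : nat) : Prop :=
  [/\ forall j x y, j < n -> x \in c j -> y \in c j -> row_of m n x = row_of m n y,
      forall i j x y, i < j -> j < n -> x \in c i -> y \in c j -> y < x &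
      forall i j x y, i < j -> j < n -> x \in c i -> y \in c j ->
        row_of m n x = row_of m n y \/ i < row_of m n y].

Lemma contains_index4 (s : seq nat) a b c d q : uniq s ->
  [/\ a \in s, b \in s, c \in s & d \in s] ->
  index a s < index b s -> index b s < index c s -> index c s < index d s ->
  order_iso [:: a; b; c; d] q -> contains s q.
Proof.
move=> us [? ? ? ?] ab bc cd iso; exists [:: a; b; c; d] => //.
apply: sorted_index_subseq => //=; last by rewrite ab bc cd.
by move=> x; rewrite !inE => /or4P [] /eqP ->.
Qed.

Lemma mem_word_min m c n i : i < n -> m i \in word m c n.
Proof. by move=> ?; apply/mem_word; exists i; rewrite // mem_head. Qed.

Lemma mem_word_column (m : nat -> nat) (c : nat -> seq nat) n j x :
  j < n -> x \in c j -> x \in word m c n.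
Proof. by move=> ? xj; apply/mem_word; exists j; rewrite // inE xj orbT. Qed.

Lemma column_neq_min m c n i j x : uniq (word m c n) -> i < n -> j < n ->
  x \in c j -> x != m i.
Proof.
move=> uw lt_in jn xj; apply: contraTneq (leqnn (index x (word m c n))) => e.
have xj' : x \in m j :: c j by rewrite inE xj orbT.
rewrite -ltnNge; case: (ltngtP i j) => [ij|ji|eij].
- by rewrite {1}e; apply: word_index_lt uw ij jn (mem_head _ _) xj'.
- by rewrite {2}e; apply: word_index_lt uw ji lt_in xj' (mem_head _ _).
- by rewrite {1}e; apply: word_index_min => //; rewrite eij.
Qed.

Lemma word_index_min_column m c n i j x : uniq (word m c n) -> i <= j -> j < n ->
  x \in c j -> index (m i) (word m c n) < index x (word m c n).
Proof.
move=> uw; rewrite leq_eqVlt => /predU1P [->|ij] jn xj.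
  exact: word_index_min.
by apply: (word_index_lt uw ij); rewrite // ?mem_head // inE xj orbT.
Qed.

Lemma avoid_skew_columns m c n : wf_columns m c n -> uniq (word m c n) ->
  (forall q, basis3 q -> ~ contains (word m c n) q) -> skew_columns m c n.
Proof.
move=> wf uw av; set w := word m c n in uw av.
have row_sep x i : i < n -> i < row_of m n x -> x <= m i.
  by move=> lt_in; rewrite [x <= _]leqNgt (min_lt_row_of x wf) // -ltnNge.
have min_lt i j : i < j -> j < n -> index (m i) w < index (m j) w.
  by move=> ij jn; apply: word_index_lt uw ij jn _ _; rewrite mem_head.
(* The letters [m i], [m k], [x], [y] would form 3142. *)
have av3 i k j l x y : i < k -> k <= j -> j < n -> l < n -> x \in c j -> y \in c l ->
    m k < y -> y < m i -> m i < x -> index x w < index y w -> False.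
  move=> ik kj jn ln xj yl ky yi ix xy.
  have kn := leq_ltn_trans kj jn; have lt_in := ltn_trans ik kn.
  apply: (av [:: 3; 1; 4; 2]); first by right.
  apply: (@contains_index4 _ (m i) (m k) x y) => //; last exact/order_iso_3142.
  - by rewrite !mem_word_min ?(mem_word_column _ jn xj) ?(mem_word_column _ ln yl).
  - exact: min_lt.
  - exact: (word_index_min_column uw kj jn xj).
(* Let [i] and [k] be the two rows. After [m i] and [m k], the order [x], [y] gives 3142 and the
   order [y], [x] gives 3124. *)
have G1 j x y : j < n -> x \in c j -> y \in c j -> ~ row_of m n x < row_of m n y.
  move=> jn xj yj ltr; set i := row_of m n x in ltr; set k := row_of m n y in ltr.
  have kj : k <= j by apply: row_of_le wf _ _.
  have kn := leq_ltn_trans kj jn; have lt_in := ltn_trans ltr kn.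
  have ky : m k < y by rewrite (min_lt_row_of y wf).
  have yi : y < m i by rewrite ltn_neqAle (column_neq_min uw _ jn) ?row_sep.
  have ix : m i < x by rewrite (min_lt_row_of x wf).
  case: (ltngtP (index x w) (index y w)) => [xy|yx|exy]; first exact: (av3 i k j j x y).
    apply: (av [:: 3; 1; 2; 4]); first by left; right.
    apply: (@contains_index4 _ (m i) (m k) y x) => //; last exact/order_iso_3124.
    - by rewrite !mem_word_min ?(mem_word_column _ jn xj) ?(mem_word_column _ jn yj).
    - exact: min_lt.
    - exact: (word_index_min_column uw kj jn yj).
  have exy' : x = y.
    by rewrite -(nth_index 0 (mem_word_column m jn xj)) -/w exy nth_index //
      (mem_word_column m jn yj).
  by move: ltr; rewrite /i /k exy' ltnn.
(* An ascent from [x] to [y] would make [m k], [x], [m j], [y] a copy of 2314, with [k] the row of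
   [x]. *)
have G2 i j x y : i < j -> j < n -> x \in c i -> y \in c j -> y < x.
  move=> ij jn xi yj; have lt_in := ltn_trans ij jn.
  have ri := row_of_le wf lt_in xi; set k := row_of m n x in ri.
  have xj : index x w < index (m j) w.
    by apply: (word_index_lt uw ij) => //; rewrite inE ?xi ?eqxx ?orbT.
  have jy : index (m j) w < index y w by apply: word_index_min.
  rewrite ltn_neqAle; case: eqP => [e|_] /=.
    by have := ltn_trans xj jy; rewrite e ltnn.
  rewrite leqNgt; apply/negP => xy.
  have kj := leq_ltn_trans ri ij; have kn := ltn_trans kj jn.
  apply: (av [:: 2; 3; 1; 4]); first by left; left.
  apply: (@contains_index4 _ (m k) x (m j) y) => //.
  - by rewrite !mem_word_min ?(mem_word_column _ lt_in xi) ?(mem_word_column _ jn yj).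
  - exact: (word_index_min_column uw ri lt_in xi).
  - apply/order_iso_2314; split=> //; first exact: (proj1 wf).
    by rewrite (min_lt_row_of x wf).
split=> // [j x y jn xj yj|i j x y ij jn xi yj].
  case: (ltngtP (row_of m n x) (row_of m n y)) => // h.
    by case: (G1 j x y).
  by case: (G1 j y x).
have yx := G2 _ _ _ _ ij jn xi yj; have lt_in := ltn_trans ij jn.
have ry := row_of_le wf jn yj; have rx := row_of_le wf lt_in xi.
(* Later columns hold smaller entries, so rows weakly increase from left to right. *)
have lexy : row_of m n x <= row_of m n y.
  rewrite -(min_lt_row_of x wf) ?(leq_ltn_trans ry) //; apply: ltn_trans yx.
  by rewrite (min_lt_row_of y wf) ?(leq_ltn_trans ry).
case: (ltnP i (row_of m n y)) => [|yi]; first by right.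
(* Otherwise the minima of the two rows, both placed before [x], would complete a 3142 with [x] and
   [y]. *)
left; apply/eqP; rewrite eqn_leq lexy leqNgt; apply/negP => ltr.
apply: (av3 (row_of m n x) (row_of m n y) i j x y) => //.
- by rewrite (min_lt_row_of y wf) ?(leq_ltn_trans ry).
- by rewrite ltn_neqAle (column_neq_min uw _ jn) ?row_sep // (leq_ltn_trans rx).
- by rewrite (min_lt_row_of x wf) // (leq_ltn_trans rx).
- by apply: (word_index_lt uw ij) => //; rewrite inE ?xi ?yj orbT.
Qed.

(** A minimum is below every earlier letter, so the top of an ascent is never one. *)
Lemma word_ascent_column m c n x y : wf_columns m c n -> uniq (word m c n) ->
  x \in word m c n -> y \in word m c n ->
  index x (word m c n) < index y (word m c n) -> x < y ->
  exists2 j, j < n & y \in c j.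
Proof.
move=> wf uw /mem_word [i lt_in xi] /mem_word [j jn].
rewrite inE => /predU1P [ey xy lxy|]; last by exists j.
have ij : i <= j.
  by apply: (word_index_le uw lt_in xi (mem_head (m j) (c j))); rewrite -ey ltnW.
have mji : m j <= m i.
  by move: ij; rewrite leq_eqVlt => /predU1P [->//|ij]; rewrite ltnW // (proj1 wf).
have mix : m i <= x.
  by move: xi; rewrite inE => /predU1P [->//|xi]; rewrite ltnW // (proj2 wf).
by move: lxy; rewrite ey ltnNge (leq_trans mji mix).
Qed.

(** An occurrence of any of the three patterns is forced into a single column, where the hypothesis
    on columns excludes it; one configuration of 3142 contradicts the third clause instead. *)
Lemma skew_columns_avoid m c n : wf_columns m c n -> uniq (word m c n) ->
  skew_columns m c n ->
  (forall j q, j < n -> basis3 q -> ~ contains (c j) q) ->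
  forall q, basis3 q -> ~ contains (word m c n) q.
Proof.
move=> wf uw [G1 G2 G3] avc; set w := word m c n in uw *.
have in_all t q : subseq t w -> order_iso t q -> basis3 q ->
    (exists2 j, j < n & {subset t <= c j}) -> False.
  move=> tw iso bq [j jn tc]; apply: (avc j q) => //.
  by exists t => //; apply: column_subseq uw jn tw tc.
have wP x : x \in w -> (exists2 i, i < n & x = m i) \/ (exists2 j, j < n & x \in c j).
  case/mem_word=> j jn; rewrite inE => /predU1P [->|xj]; last by right; exists j.
  by left; exists j.
have consP j x : x \in c j -> x \in m j :: c j by rewrite inE => ->; rewrite orbT.
have nonmin x y := @word_ascent_column m c n x y wf uw.
(* Three tools: two entries forming an ascent share a column; a letter placed between two entries of
   a column belongs to it; no minimum has a value between two entries of a column. *)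
have same i j x y : i < n -> j < n -> x \in c i -> y \in c j ->
    index x w < index y w -> x < y -> i = j.
  move=> lt_in jn xi yj xy lxy; have ij : i <= j.
    by apply: (word_index_le uw lt_in (consP _ _ xi) (consP _ _ yj)); rewrite ltnW.
  move: ij; rewrite leq_eqVlt => /predU1P [//|ij].
  by move: lxy; rewrite ltnNge ltnW // (G2 i j).
have betw j x z y : j < n -> x \in c j -> y \in c j -> z \in w ->
    index x w < index z w -> index z w < index y w -> z \in c j.
  move=> jn xj yj /mem_word [i lt_in zi] xz zy.
  have ij : i <= j by apply: (word_index_le uw lt_in zi (consP _ _ yj)); rewrite ltnW.
  have ji : j <= i by apply: (word_index_le uw jn (consP _ _ xj) zi); rewrite ltnW.
  have e : i = j by apply/eqP; rewrite eqn_leq ij ji.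
  move: zi; rewrite e inE => /predU1P [ez|//].
  by rewrite ez in xz; have := ltn_trans xz (word_index_min uw jn xj); rewrite ltnn.
have minbetw i j x y : i < n -> j < n -> x \in c j -> y \in c j ->
    x < m i -> m i < y -> False.
  move=> lt_in jn xj yj xi; rewrite (min_lt_row_of y wf) // (G1 j y x) //
    -(min_lt_row_of x wf) //.
  by rewrite ltnNge ltnW.
have pick4 t q : subseq t w -> order_iso t q -> size q = 4 ->
    exists a b c d, [/\ t = [:: a; b; c; d], [/\ a \in w, b \in w, c \in w & d \in w]
     & [/\ index a w < index b w, index b w < index c w & index c w < index d w]].
  move=> tw [st _] sq; have := subseq_pairwise_index uw tw.
  have : {subset t <= w} by apply: mem_subseq.
  case: t st {tw} => [|a [|b [|c' [|d []]]]]; rewrite sq // => _ tw.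
  move=> /= /and4P [/and4P [ab _ _ _] /and3P [bc _ _] /andP [cd _] _].
  by exists a, b, c', d; split=> //; split; apply: tw; rewrite !inE eqxx ?orbT.
move=> q bq [t tw iso]; apply: (in_all t q tw iso bq).
case: bq => [[]|] eq; rewrite {q}eq in iso.
(* In 2314 the letters 3 and 4 form an ascent and 1 is placed between them; a minimum in the role of
   2 would separate the values 1 and 3. *)
- have [a [b [d [e [et [aw bw dw ew] [ab bd de]]]]]] := pick4 t _ tw iso erefl.
  rewrite et in iso *; case/order_iso_2314: iso => lda lab lbe.
  have [j jn ej] := nonmin _ _ dw ew de (ltn_trans lda (ltn_trans lab lbe)).
  have [j' jn' bj] := nonmin _ _ aw bw ab lab.
  have ejj := same _ _ _ _ jn' jn bj ej (ltn_trans bd de) lbe; subst j'.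
  have dj := betw _ _ _ _ jn bj ej dw bd de.
  exists j => // x; rewrite !inE => /or4P [] /eqP -> //.
  case: (wP a aw) => [[i lt_in ea]|[i lt_in ai]].
    by case: (minbetw i j d b) => //; rewrite -ea.
  by rewrite -(same _ _ _ _ lt_in jn ai bj ab lab).
(* In 3124 the letters 2 and 4 form an ascent; a minimum in the role of 3 would separate their
   values, and 1 is placed between 3 and 2. *)
- have [a [b [d [e [et [aw bw dw ew] [ab bd de]]]]]] := pick4 t _ tw iso erefl.
  rewrite et in iso *; case/order_iso_3124: iso => lbd lda lae.
  have [j jn ej] := nonmin _ _ dw ew de (ltn_trans lda lae).
  have [j' jn' dj] := nonmin _ _ bw dw bd lbd.
  have ejj := same _ _ _ _ jn' jn dj ej de (ltn_trans lda lae); subst j'.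
  have aj : a \in c j.
    case: (wP a aw) => [[i lt_in ea]|[i lt_in ai]].
      by case: (minbetw i j d e) => //; rewrite -ea.
    by rewrite -(same _ _ _ _ lt_in jn ai ej (ltn_trans ab (ltn_trans bd de)) lae).
  have bj := betw _ _ _ _ jn aj dj bw ab bd.
  by exists j => // x; rewrite !inE => /or4P [] /eqP ->.
(* In 3142 the letters 4 and 2 both end ascents from 1. If they share a column, a minimum in the
   role of 3 would separate their values. *)
- have [a [b [d [e [et [aw bw dw ew] [ab bd de]]]]]] := pick4 t _ tw iso erefl.
  rewrite et in iso *; case/order_iso_3142: iso => lbe lea lad.
  have lbd : b < d by apply: ltn_trans lbe (ltn_trans lea lad).
  have [j jn dj] := nonmin _ _ bw dw bd lbd.
  have [l ln el] := nonmin _ _ bw ew (ltn_trans bd de) lbe.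
  have jl : j <= l by apply: (word_index_le uw jn (consP _ _ dj) (consP _ _ el)); rewrite ltnW.
  have aj i : i < n -> a \in c i -> a \in c j.
    by move=> lt_in ai; rewrite -(same _ _ _ _ lt_in jn ai dj (ltn_trans ab bd) lad).
  move: jl; rewrite leq_eqVlt => /predU1P [ejl|jl].
    subst l; have aj' : a \in c j.
      case: (wP a aw) => [[i lt_in ea]|[i lt_in ai]]; last exact: aj ai.
      by case: (minbetw i j e d) => //; rewrite -ea.
    have bj := betw _ _ _ _ jn aj' dj bw ab bd.
    by exists j => // x; rewrite !inE => /or4P [] /eqP ->.
  (* When 4 and 2 lie in different columns, 1 and 3 must both be minima, and the rows of 4 and 2
     then contradict the third clause. *)
  have bnj : b \notin c j.
    by apply/negP => bj; have := G2 _ _ _ _ jl ln bj el; rewrite ltnNge ltnW.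
  case: (wP b bw) => [[k kn eb]|[k kn bk]]; last first.
    by move: bnj; rewrite -(same _ _ _ _ kn jn bk dj bd lbd) bk.
  case: (wP a aw) => [[i lt_in ea]|[i lt_in /(aj _ lt_in) ai]]; last first.
    by move: bnj; rewrite (betw _ _ _ _ jn ai dj bw ab bd).
  have kj : k <= j.
    by apply: (word_index_le uw kn (mem_head _ _) (consP _ _ dj)); rewrite -eb -/w ltnW.
  have rk : row_of m n e <= k by rewrite -(min_lt_row_of e wf) // -eb.
  have rie : i < row_of m n e by rewrite ltnNge -(min_lt_row_of e wf) // -leqNgt -ea ltnW.
  have rid : row_of m n d <= i by rewrite -(min_lt_row_of d wf) // -ea.
  case: (G3 _ _ _ _ jl ln dj el) => [er|jr].
    by move: rie; rewrite -er ltnNge rid.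
  by move: jr; rewrite ltnNge (leq_trans rk kj).
Qed.

(** The letters playing [p] end ascents, hence are non-minima. Those in the first column met exceed
    those in later columns, so skew-indecomposability leaves no later column. *)
Lemma skew_columns_avoid_one_oplus m c n p : wf_columns m c n ->
  uniq (word m c n) -> skew_columns m c n ->
  is_perm p -> p <> [::] -> skew_indecomposable p ->
  (forall j, j < n -> ~ contains (c j) p) -> ~ contains (word m c n) (one_oplus p).
Proof.
move=> wf uw [_ G2 _] pp p0 sp avc [t tw iso]; set w := word m c n in uw tw.
case: t => [|a u] in tw iso; first by case: iso.
case/(order_iso_one_oplus _ _ pp): iso => iso /allP au.
have uw_sub : {subset a :: u <= w} by apply: mem_subseq.
have /= /andP [/allP a_u pw] := subseq_pairwise_index uw tw.
have colP x : x \in u -> exists2 j, j < n & x \in c j.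
  move=> xu; apply: (word_ascent_column wf uw (uw_sub a (mem_head _ _))).
  - by rewrite uw_sub // inE xu orbT.
  - exact: a_u.
  - exact: au.
case: u => [|y0 u'] in iso au a_u pw colP tw uw_sub.
  by case: iso => /esym/size0nil.
set u := y0 :: u' in iso au a_u pw colP tw uw_sub.
have [j jn y0j] := colP y0 (mem_head _ _).
have consP i x : x \in c i -> x \in m i :: c i by rewrite inE => ->; rewrite orbT.
have colPj x : x \in u -> exists i, [/\ j <= i, i < n & x \in c i].
  move=> xu; have [i lt_in xi] := colP x xu; exists i; split=> //.
  apply: (word_index_le uw jn (consP _ _ y0j) (consP _ _ xi)).
  move: xu; rewrite inE => /predU1P [->//|xu']; rewrite ltnW //.
  by case/andP: pw => /allP/(_ x xu').
(* No letter of [u] lies in a column before [j], and columns are met in weakly increasing order, so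
   the letters of column [j] come first. *)
have /filter_cat_predC eu : pairwise (fun x y => (y \in c j) ==> (x \in c j)) u.
  apply: (sub_in_pairwise (P := mem u)) pw; last by apply/allP => x.
  move=> x y /colPj [i [ji lt_in xi]] _ xy; apply/implyP => yj.
  have ij : i <= j.
    by apply: (word_index_le uw lt_in (consP _ _ xi) (consP _ _ yj)); rewrite ltnW.
  by have -> : j = i by apply/eqP; rewrite eqn_leq ij ji.
rewrite eu in iso; case: (skew_indecomposable_split pp sp iso).
- move=> x y; rewrite !mem_filter => /andP [xj _] /andP [/= ynj /colPj [i [ji lt_in yi]]].
  move: ji; rewrite leq_eqVlt => /predU1P [eji|ji]; last exact: (G2 j i).
  by rewrite eji yi in ynj.
- by rewrite /u /= y0j.
- move=> e; apply: (avc j) => //; exists u.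
    apply: (column_subseq uw jn); first exact: subseq_trans (subseq_cons u a) tw.
    by move=> x; rewrite eu e cats0 mem_filter => /andP [].
  by rewrite eu.
Qed.

(** * The cells of an avoiding word *)

(** The clauses of [skew_columns] exclude column, up and down edges, in this order. The minimum
    heading a column turns an occurrence of [p] in a cell into one of [one_oplus p]. *)
Lemma SE_word_WI m c n (P : set (seq nat)) : wf_columns m c n ->
  uniq (word m c n) -> skew_columns m c n ->
  (forall p, P p -> is_perm p) ->
  (forall q, (basis3 `|` one_oplus @` P)%classic q -> ~ contains (word m c n) q) ->
  WI (@UDC n) (Av_plus (basis3 `|` P)%classic) (SE n (word m c n)).
Proof.
move=> wf uw [G1 G2 G3] Pp av; set f := SE n _.
have cellP d : d \in nonempty_cells f ->
    exists2 x, x \in c (cell_col d) & row_of m n x = cell_row d.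
  rewrite inE SE_word // standardize_nil => /eqP e.
  case E: [seq x <- c (cell_col d) | row_of m n x == cell_row d] => [|x l] //.
  have : x \in x :: l by rewrite mem_head.
  by rewrite -E mem_filter => /andP [/eqP ? ?]; exists x.
have Gup d e : d \in nonempty_cells f -> e \in nonempty_cells f ->
    cell_col d < cell_col e -> cell_row d <= cell_row e.
  move=> /cellP [x xd <-] /cellP [y ye ry] de.
  have yx := G2 _ _ _ _ de (ltn_ord _) xd ye.
  by rewrite -(min_lt_row_of x wf) //; apply: ltn_trans yx; rewrite (min_lt_row_of y wf) // ry.
have Gdown d e : d \in nonempty_cells f -> e \in nonempty_cells f -> ~~ down_edge d e.
  move=> hd he; apply/negP => /and3P [rde cde /fintype.subsetP rect].
  (* The bottom left corner of the rectangle lies in the staircase only if the row of [e] is at most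
     the column of [d]. *)
  have : (cell_row e, cell_col d) \in staircase n.
    by apply: rect; rewrite inE /= (ltnW rde) (ltnW cde) !leqnn.
  case/cellP: hd => x xd rx; case/cellP: he => y ye ry.
  rewrite inE /= -ry => le_rc; case: (G3 _ _ _ _ cde (ltn_ord _) xd ye).
    by rewrite rx ry => e'; rewrite e' ltnn in rde.
  by rewrite ltnNge le_rc.
have Gnup d e : d \in nonempty_cells f -> e \in nonempty_cells f -> ~~ up_edge d e.
  by move=> hd he; apply/negP => /andP [rde /(Gup _ _ hd he)]; rewrite leqNgt rde.
split.
  move=> d e hd he; apply/negP => /andP [nde].
  rewrite (negbTE (Gnup _ _ hd he)) (negbTE (Gnup _ _ he hd)).
  rewrite (negbTE (Gdown _ _ hd he)) (negbTE (Gdown _ _ he hd)) /= => /eqP ecol.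
  case/negP: nde; apply/eqP/val_inj.
  case/cellP: hd => x xd rx; case/cellP: he => y ye ry.
  have erow : cell_row d = cell_row e.
    by apply: val_inj; rewrite /= -rx -ry; apply: (G1 (cell_col d)); rewrite // ecol.
  by rewrite [LHS]surjective_pairing [RHS]surjective_pairing; congr pair.
move=> d; rewrite inE SE_word // standardize_nil => e0.
set l := [seq x <- _ | _] in e0 *.
have lw : subseq l (c (cell_col d)) by apply: filter_subseq.
have cw := column_cons_subseq m c (ltn_ord (cell_col d)).
have cw' := subseq_trans (subseq_cons (c (cell_col d)) (m (cell_col d))) cw.
split; last by apply/eqP; rewrite standardize_nil.
split.
  by apply: is_perm_standardize; apply: subseq_uniq lw (subseq_uniq cw' uw).
move=> q [bq|Pq] /contains_standardize cl.
  by apply: (av q); [left|apply: subseq_contains cl; apply: subseq_trans cw'].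
apply: (av (one_oplus q)); first by right; exists q.
case: cl => t tl iso; exists (m (cell_col d) :: t).
  apply: subseq_trans cw; rewrite /= eqxx; exact: subseq_trans lw.
apply/(order_iso_one_oplus _ _ (Pp q Pq)); split=> //.
apply/allP => x xt; apply: (proj2 wf) => //.
exact: (mem_subseq lw (mem_subseq tl xt)).
Qed.

(** * Injectivity *)

Lemma mem_zip_pair (s t : seq nat) u : size s = size t -> u \in zip s t ->
  u.1 \in s /\ u.2 \in t.
Proof.
move=> est uz; rewrite -{1}[s](unzip1_zip (t := t)) ?est //.
by rewrite -{2}[t](unzip2_zip (s := s)) ?est //; split; apply: map_f.
Qed.

Lemma mem_zip_word m c m' c' n u :
  (forall j, j < n -> size (c j) = size (c' j)) ->
  u \in zip (word m c n) (word m' c' n) ->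
  exists2 j, j < n & u = (m j, m' j) \/ u \in zip (c j) (c' j).
Proof.
(* Equality of lengths joins the induction because [zip] splits along a concatenation only when the
   first parts have equal length. *)
move=> H; suff [] : size (word m c n) = size (word m' c' n) /\
  (u \in zip (word m c n) (word m' c' n) ->
   exists2 j, j < n & u = (m j, m' j) \/ u \in zip (c j) (c' j)) by [].
elim: n H => //= n IH H; have [|sz IHn] := IH; first by move=> j /ltnW/H.
split; first by rewrite !size_cat /= sz H.
rewrite zip_cat // mem_cat /= inE => /orP [/IHn [j jn ?]|/predU1P [->|un]].
- by exists j; first exact: ltnW.
- by exists n; last left.
- by exists n; last right.
Qed.

(** A column occupies a single row, so its only non-empty cell carries the whole column and also
    tells its row. *)
Lemma SE_word_column m c m' c' n j : wf_columns m c n -> wf_columns m' c' n ->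
  skew_columns m c n -> skew_columns m' c' n ->
  SE n (word m c n) = SE n (word m' c' n) -> j < n ->
  order_iso (c j) (c' j) /\
  {in c j & c' j, forall x y, row_of m n x = row_of m' n y}.
Proof.
move=> wf wf' [G _ _] [G' _ _] eSE jn.
(* Only rows [i <= j] give cells of the staircase; entries of column [j] lie in no others. *)
have H i : i <= j -> standardize [seq x <- c j | row_of m n x == i] =
    standardize [seq x <- c' j | row_of m' n x == i].
  move=> ij; have lt_in := leq_ltn_trans ij jn.
  have cP : (Ordinal lt_in, Ordinal jn) \in staircase n by rewrite inE.
  pose d : cell n := exist (fun e => e \in staircase n) _ cP.
  by have := congr1 (fun g : filling n => g d) eSE; rewrite !SE_word.
have full x : x \in c j -> [seq y <- c j | row_of m n y == row_of m n x] = c j.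
  by move=> xj; apply/all_filterP/allP => y yj; rewrite (G j y x).
have full' x : x \in c' j -> [seq y <- c' j | row_of m' n y == row_of m' n x] = c' j.
  by move=> xj; apply/all_filterP/allP => y yj; rewrite (G' j y x).
case E: (c j) => [|x l].
  case E': (c' j) => [|y l'] //.
  have yj : y \in c' j by rewrite E' mem_head.
  by have := H _ (row_of_le wf' jn yj); rewrite full' // E E'.
have xj : x \in c j by rewrite E mem_head.
have := H _ (row_of_le wf jn xj); rewrite full //.
case E': [seq y <- c' j | _] => [|y l'] e; first by rewrite E in e.
have : y \in y :: l' by rewrite mem_head.
rewrite -E' mem_filter => /andP [/eqP ry yj].
rewrite -E; split.
  by apply: standardize_eq_order_iso; rewrite e -E' -ry full'.
by move=> a b aj bj; rewrite (G j a x) // (G' j b y).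
Qed.

Lemma wf_min_lt m c n i j : wf_columns m c n -> i < n -> j < n ->
  (m i < m j) = (j < i).
Proof.
move=> [Hm _] lt_in jn; case: (ltngtP i j) => [ij|ji|->]; rewrite ?ltnn //.
  by rewrite ltnNge ltnW // Hm.
by rewrite Hm.
Qed.

Lemma column_lt_min m c n i j x : wf_columns m c n -> uniq (word m c n) ->
  i < n -> j < n -> x \in c j -> (x < m i) = (i < row_of m n x).
Proof.
move=> wf uw lt_in jn xj; rewrite ltn_neqAle (column_neq_min uw lt_in jn xj) /=.
by rewrite leqNgt (min_lt_row_of x wf) // -ltnNge.
Qed.

(** Two minima compare by their column indices, a minimum and an entry by the row of the entry,
    entries of different columns by skewness, and entries of one column by its cell. The encoding
    determines all of these. *)
Lemma SE_word_order_iso m c m' c' n : wf_columns m c n -> wf_columns m' c' n ->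
  uniq (word m c n) -> uniq (word m' c' n) ->
  skew_columns m c n -> skew_columns m' c' n ->
  SE n (word m c n) = SE n (word m' c' n) ->
  order_iso (word m c n) (word m' c' n).
Proof.
move=> wf wf' uw uw' G G' eSE.
have H j := SE_word_column wf wf' G G' eSE (j := j).
have sz j : j < n -> size (c j) = size (c' j) by move=> /H [[]].
have [_ G2 _] := G; have [_ G2' _] := G'.
apply/order_iso_zip; split.
  elim: n {wf wf' uw uw' G G' eSE H G2 G2'} sz => //= n IH sz.
  by rewrite !size_cat /= sz // IH // => j /ltnW/sz.
move=> u v /(mem_zip_word sz) [i lt_in ui] /(mem_zip_word sz) [j jn vj].
case: ui => [->|ui] /=; case: vj => [->|vj] /=.
- by rewrite (wf_min_lt wf) // (wf_min_lt wf').
- have [v1 v2] := mem_zip_pair (sz _ jn) vj; have [_ Hr] := H _ jn.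
  by rewrite (min_lt_row_of _ wf) // (min_lt_row_of _ wf') // (Hr _ _ v1 v2).
- have [u1 u2] := mem_zip_pair (sz _ lt_in) ui; have [_ Hr] := H _ lt_in.
  by rewrite (column_lt_min wf uw jn lt_in u1) (column_lt_min wf' uw' jn lt_in u2)
    (Hr _ _ u1 u2).
have [u1 u2] := mem_zip_pair (sz _ lt_in) ui; have [v1 v2] := mem_zip_pair (sz _ jn) vj.
case: (ltngtP i j) => [ij|ji|e].
- rewrite (leq_gtF (ltnW (G2 _ _ _ _ ij jn u1 v1))).
  by rewrite (leq_gtF (ltnW (G2' _ _ _ _ ij jn u2 v2))).
- by rewrite (G2 _ _ _ _ ji lt_in v1 u1) (G2' _ _ _ _ ji lt_in v2 u2).
- have [/order_iso_zip [_ Hz] _] := H _ lt_in.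
  by apply: Hz; rewrite // e.
Qed.

(** * Surjectivity *)

Lemma is_lrmin_order_iso s t k : order_iso s t -> k < size s ->
  is_lrmin s k = is_lrmin t k.
Proof.
move=> [_ H] ks; apply: eq_in_all => l; rewrite mem_iota /= => lk.
by rewrite H // (ltn_trans lk).
Qed.

Lemma lrmin_pos_order_iso s t : order_iso s t -> lrmin_pos s = lrmin_pos t.
Proof.
move=> iso; rewrite /lrmin_pos -(proj1 iso); apply: eq_in_filter => k.
by rewrite mem_iota => /= ks; apply: is_lrmin_order_iso.
Qed.

Lemma row_index_order_iso s t k i : order_iso s t -> k < size s ->
  row_index s k i = row_index t k i.
Proof.
move=> iso ks; rewrite /row_index /lrmin_val -(lrmin_pos_order_iso iso) !size_map.
have H l : l < size (lrmin_pos s) ->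
    (nth 0 [seq nth 0 s k | k <- lrmin_pos s] l < nth 0 s k) =
    (nth 0 [seq nth 0 t k | k <- lrmin_pos s] l < nth 0 t k).
  move=> ls; rewrite !(nth_map 0) //; apply: (proj2 iso) => //.
  exact/lrmin_pos_lt/mem_nth.
case: (ltnP i (size (lrmin_pos s))) => //= ip; rewrite H //; congr andb.
by apply: eq_in_all => l; rewrite mem_iota => /= ls; rewrite H.
Qed.

(** The encoding sees only relative order, so a preimage may be built with arbitrary values and
    standardized at the end. *)
Lemma SE_order_iso n s t : order_iso s t -> SE n s = SE n t.
Proof.
move=> iso; apply/ffunP => d; rewrite !ffunE; apply: standardize_order_iso.
rewrite /cell_entries -(proj1 iso).
set ks := [seq k <- _ | _]; set ks' := [seq k <- _ | _].
have <- : ks = ks'.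
  apply: eq_in_filter => k; rewrite mem_iota => /= kn.
  rewrite (is_lrmin_order_iso iso) // (row_index_order_iso _ iso) //.
  by rewrite /col_index (lrmin_pos_order_iso iso).
have ksP k : k \in ks -> k < size s by rewrite mem_filter mem_iota => /andP [].
split=> [|i j]; first by rewrite !size_map.
rewrite !size_map => lti ltj; rewrite !(nth_map 0) //.
by apply: (proj2 iso); apply/ksP/mem_nth.
Qed.

(** * Decoding an independent filling into a word *)

(** The successor puts it strictly above every letter of a cell holding a permutation and keeps it
    positive. *)
Definition cell_bound n (f : filling n) : nat := (\max_(d : cell n) size (f d)).+1.

(** The values of a word with cells [f]: each row is an interval of length
    [n.+1 * cell_bound f] starting at its minimum, cut into intervals of length
    [cell_bound f], one per column, later columns lower. *)
Definition min_key n (f : filling n) (i : nat) : nat :=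
  (n - i) * (n.+1 * cell_bound f).

Definition entry_key n (f : filling n) (d : cell n) (x : nat) : nat :=
  min_key f (cell_row d) + ((n - cell_col d) * cell_bound f + x).

(** In an independent filling at most one cell of a column is non-empty. *)
Definition column_key n (f : filling n) (j : nat) : seq nat :=
  if [pick d : cell n | (cell_col d == j :> nat) && (f d != [::])] is Some d
  then map (entry_key f d) (f d) else [::].

Lemma min_key_ltn n (f : filling n) i j : i < j -> j <= n -> min_key f j < min_key f i.
Proof. by move=> ij jn; rewrite ltn_pmul2r // ltn_sub2l // (leq_trans ij). Qed.

(** The offset of an entry above the minimum of its row is positive and less than the height
    [n.+1 * cell_bound f] of a row, so the entry stays strictly inside its row. *)
Lemma entry_key_min n (f : filling n) d x i : 0 < x -> x < cell_bound f -> i < n ->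
  (min_key f i < entry_key f d x) = (cell_row d <= i) /\ entry_key f d x != min_key f i.
Proof.
move=> x0 xB lt_in; have rn := ltn_ord (cell_row d).
case: (leqP (cell_row d) i) => [ri|ir].
  have H : min_key f i < entry_key f d x.
    apply: (@leq_ltn_trans (min_key f (cell_row d))).
      by rewrite leq_mul2r leq_sub2l ?orbT.
    by rewrite -[X in X < _]addn0 ltn_add2l ltn_addl.
  by rewrite H gtn_eqF.
have H : entry_key f d x < min_key f i.
  apply: (@leq_trans (min_key f (cell_row d) + n.+1 * cell_bound f)).
    rewrite ltn_add2l mulSn [cell_bound f + _]addnC -addnS leq_add //.
    by rewrite leq_mul2r leq_subr orbT.
  by rewrite -mulSnr leq_mul2r ltn_sub2l ?orbT.
by rewrite ltn_eqF // ltnNge ltnW.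
Qed.

(** A later column starts at least [cell_bound f] lower, which exceeds [y], and the minimum of its
    row is no higher. *)
Lemma entry_key_ltn n (f : filling n) d e x y : 0 < x -> y < cell_bound f ->
  cell_col d < cell_col e -> cell_row d <= cell_row e ->
  entry_key f e y < entry_key f d x.
Proof.
move=> x0 yB cde rde; rewrite -addnS leq_add //.
  by rewrite leq_mul2r leq_sub2l ?orbT.
apply: (@leq_trans ((n - cell_col e).+1 * cell_bound f)).
  by rewrite mulSnr -addnS leq_add2l.
by apply: leq_trans (leq_addr _ _); rewrite leq_mul2r ltn_sub2l ?orbT.
Qed.

(** The word with minima [min_key f] and columns [column_key f] has the right cells; independence
    translates into [skew_columns], which gives avoidance. *)
Lemma WI_decode n (P : set (seq nat)) (f : filling n) :
  (forall p, P p -> [/\ is_perm p, p <> [::] & skew_indecomposable p]) ->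
  WI (@UDC n) (Av_plus (basis3 `|` P)%classic) f ->
  exists2 s, Av_lrmin n (basis3 `|` one_oplus @` P)%classic s & SE n s = f.
Proof.
move=> PP [ind fS]; set m := min_key f; set c := column_key f.
have fperm d : f d != [::] -> is_perm (f d).
  by move=> fd; have [[]] : Av_plus (basis3 `|` P)%classic (f d) by apply: fS; rewrite inE.
have fB d x : x \in f d -> 0 < x /\ x < cell_bound f.
  move=> xd; have fd : f d != [::] by apply: contraTneq xd => ->.
  move: xd; rewrite is_perm_mem ?fperm // => /andP [-> xs]; split=> //.
  by rewrite ltnS (leq_trans xs) // (leq_bigmax (F := fun d => size (f d))).
have fne d x : x \in f d -> d \in nonempty_cells f.
  by rewrite inE => xd; apply: contraTneq xd => ->.
have colinj d e : d \in nonempty_cells f -> e \in nonempty_cells f ->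
    cell_col d = cell_col e :> nat -> d = e.
  move=> hd he ede; apply/eqP; have := ind _ _ hd he; rewrite /UDC.
  by case: eqVneq => //= _; rewrite (val_inj ede) eqxx !orbT.
have cP j x : x \in c j -> exists d y,
    [/\ cell_col d = j :> nat, y \in f d & x = entry_key f d y].
  rewrite /c /column_key; case: pickP => // d /andP [/eqP dj _] /mapP [y yd ->].
  by exists d, y.
have cE d : f d != [::] -> c (cell_col d) = map (entry_key f d) (f d).
  move=> fd; rewrite /c /column_key; case: pickP => [e /andP [/eqP ej fe]|/(_ d)].
    by rewrite (colinj e d) ?inE.
  by rewrite eqxx fd.
have Gup d e : d \in nonempty_cells f -> e \in nonempty_cells f ->
    cell_col d < cell_col e -> cell_row d <= cell_row e.
  move=> hd he cde; rewrite leqNgt; apply/negP => red.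
  have := ind _ _ hd he; rewrite /UDC /up_edge cde red /= andbT negbK => /eqP ede.
  by rewrite ede ltnn in cde.
have Gdown d e : d \in nonempty_cells f -> e \in nonempty_cells f ->
    cell_col d < cell_col e -> cell_row d < cell_row e -> cell_col d < cell_row e.
  move=> hd he cde rde; rewrite ltnNge; apply/negP => red.
  have := ind _ _ hd he; rewrite /UDC /down_edge cde rde /=.
  (* When the row of [e] is at most the column of [d], the whole rectangle lies in the staircase. *)
  have -> /= : rectangle (cell_row d) (cell_row e) (cell_col d) (cell_col e) \subset staircase n.
    apply/fintype.subsetP => -[a b]; rewrite !inE /= => /andP [/andP [_ ae] /andP [db _]].
    exact: leq_trans ae (leq_trans red db).
  rewrite !orbT andbT negbK => /eqP ede.
  by rewrite ede ltnn in cde.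
have wf : wf_columns m c n.
  split=> [i j ij jn|j x jn /cP [d [y [dj yd ->]]]].
    by apply: min_key_ltn => //; apply: ltnW.
  have [y0 yB] := fB _ _ yd; have [-> _] := entry_key_min d y0 yB jn.
  by have := valP d; rewrite inE -dj.
have rowE d y : y \in f d -> row_of m n (entry_key f d y) = cell_row d.
  move=> /fB [y0 yB]; apply: (row_of_unique wf) => // i lt_in.
  by have [] := entry_key_min d y0 yB lt_in.
have sk : skew_columns m c n.
  split.
  - move=> j _ _ jn /cP [d [x [dj xd ->]]] /cP [e [y [ej ye ->]]].
    by rewrite !rowE // (colinj d e) ?(fne _ _ xd) ?(fne _ _ ye) // dj.
  - move=> i j _ _ ij jn /cP [d [x [dj xd ->]]] /cP [e [y [ej ye ->]]].
    have [x0 _] := fB _ _ xd; have [_ yB] := fB _ _ ye.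
    by apply: entry_key_ltn => //; [|apply: Gup; rewrite ?(fne _ _ xd) ?(fne _ _ ye) //];
      rewrite dj ej.
  - move=> i j _ _ ij jn /cP [d [x [dj xd ->]]] /cP [e [y [ej ye ->]]].
    rewrite !rowE //; have cde : cell_col d < cell_col e by rewrite dj ej.
    have := Gup _ _ (fne _ _ xd) (fne _ _ ye) cde.
    rewrite leq_eqVlt => /predU1P [|rde]; [by left|right].
    by rewrite -dj; apply: Gdown; rewrite ?(fne _ _ xd) ?(fne _ _ ye).
have cuniq j : uniq (c j).
  rewrite /c /column_key; case: pickP => // d /andP [_ /fperm/is_perm_uniq ud].
  by rewrite map_inj_uniq // => x y /addnI/addnI.
have uw : uniq (word m c n).
  apply: uniq_word => // [i j x lt_in jn /cP [d [y [_ /fB [y0 yB] ->]]]|i j x ij jn xi].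
    by have [] := entry_key_min d y0 yB lt_in.
  by apply/negP => xj; have [_ /(_ i j x x ij jn xi xj)] := sk; rewrite ltnn.
have SEw : SE n (word m c n) = f.
  apply/ffunP => d; rewrite SE_word //; case: (eqVneq (f d) [::]) => [fd|fd].
    rewrite fd; apply/eqP; rewrite standardize_nil -size_eq0 -leqn0 leqNgt.
    rewrite size_filter -has_count; apply/hasPn => x /cP [e [y [ej ye ->]]].
    rewrite rowE //; apply/negP => /eqP re.
    have ede : e = d.
      apply: val_inj; rewrite [LHS]surjective_pairing [RHS]surjective_pairing.
      by congr pair; apply: val_inj.
    by rewrite ede fd in ye.
  rewrite cE // (all_filterP _); last first.
    by apply/allP => _ /mapP [y yd ->]; rewrite rowE.
  rewrite -[RHS]standardize_perm ?fperm //; apply/esym/standardize_order_iso.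
  by apply: order_iso_map => x y _ _; rewrite !ltn_add2l.
have cav j q : (basis3 `|` P)%classic q -> ~ contains (c j) q.
  move=> bq; rewrite /c /column_key; case: pickP => [d /andP [_ fd]|_]; last first.
    (* An empty column contains only the empty word, which is neither in [basis3] nor in [P]. *)
    case=> t; rewrite subseq0 => /eqP -> [/esym/size0nil e _]; move: bq; rewrite e.
    by case=> [[[]|]|/PP []].
  move=> cq; have [[_ av] _] : Av_plus (basis3 `|` P)%classic (f d).
    by apply: fS; rewrite inE.
  apply: (av q bq); apply: order_iso_contains cq; apply/order_iso_sym.
  by apply: order_iso_map => x y _ _; rewrite !ltn_add2l.
have iso := order_iso_standardize (word m c n).
(* The keys leave gaps, so the preimage is the standardized word. *)
exists (standardize (word m c n)); last by rewrite -(SE_order_iso n iso).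
split; last by rewrite -(lrmin_pos_order_iso iso) size_lrmin_pos_word.
split; first exact: is_perm_standardize.
move=> q [bq|[p Pp <-]] /contains_standardize.
  by apply: (skew_columns_avoid wf uw sk) => // j q' _ ?; apply: cav; left.
have [pp p0 sp] := PP _ Pp.
by apply: (skew_columns_avoid_one_oplus wf uw sk) => // j _; apply: cav; right.
Qed.

(** * The bijection *)

Local Open Scope classical_set_scope.

Theorem theorem6p1 (P : set (seq nat))
    (P_perm : forall p, P p -> is_perm p /\ p <> [::])
    (P_skew : forall p, P p -> skew_indecomposable p)
    (n : nat) :
  set_bij (Av_lrmin n (basis3 `|` one_oplus @` P))
          (WI (@UDC n) (Av_plus (basis3 `|` P)))
          (SE n).
Proof.
(* Each word of the domain has a column form, with [n] columns since columns correspond to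
   left-to-right minima. *)
have dec s : Av_lrmin n (basis3 `|` one_oplus @` P) s -> exists m c,
    [/\ s = word m c n, wf_columns m c n, uniq (word m c n) & skew_columns m c n].
  move=> [[ps av] sn]; have us := is_perm_uniq ps.
  have [n' [m [c [es wf]]]] := word_exists us.
  have en : n' = n by rewrite -sn es size_lrmin_pos_word.
  subst n'; exists m, c; rewrite -es; split=> //.
  apply: avoid_skew_columns => //; rewrite -es // => q bq.
  by apply: av; left.
split.
- move=> s As; have [m [c [es wf uw sk]]] := dec s As.
  rewrite es; apply: SE_word_WI => //; first by move=> p /P_perm [].
  by rewrite -es; case: As => [[]].
- move=> s t /set_mem As /set_mem At e.
  have [m [c [es wf uw sk]]] := dec s As; have [m' [c' [et wf' uw' sk']]] := dec t At.
  (* Order-isomorphic permutations coincide, so the two words need only be compared up to order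
     isomorphism. *)
  apply: order_iso_perm_eq; [by case: As => [[]]|by case: At => [[]]|].
  by rewrite es et; apply: SE_word_order_iso => //; rewrite -es -et.
- move=> f Wf; have [|s As <-] := WI_decode _ Wf; last by exists s.
  by move=> p Pp; have [? ?] := P_perm _ Pp; split=> //; apply: P_skew.
Qed.
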